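(* For all integers $1\le n'\le n$: $\mathrm{LTOCC}_{n'}\subseteq\mathrm{LTOCC}_n$ and $\mathrm{LTOCC}_{n'}+\mathrm M\subseteq\mathrm{LTOCC}_n+\mathrm M$.
   Context: Alice and Bob hold systems in energy-incoherent states (probability vectors), with Gibbs vectors $\gamma^{(A)},\gamma^{(B)}$ with strictly positive entries. A local thermal operation is a (column-)stochastic matrix $\Lambda$ with $\Lambda\gamma=\gamma$ for the corresponding Gibbs vector. Indices $k,l$ denote Alice's and Bob's inputs, $i,j$ their outputs. Thermal tensors: $T^{(B)}_{jkl}\ge0$, $\sum_jT^{(B)}_{jkl}=1$, $\sum_lT^{(B)}_{jkl}\gamma^{(B)}_l=\gamma^{(B)}_j$ for all $j,k$; $T^{(A)}_{ikl}\ge0$, $\sum_iT^{(A)}_{ikl}=1$, $\sum_kT^{(A)}_{ikl}\gamma^{(A)}_k=\gamma^{(A)}_i$ for all $i,l$. $\mathrm{LTOCC}_n$: products $M=\prod_{\alpha=1}^nM^{(\alpha)}$ of stochastic matrices each of the form $M^{(\alpha)}_{ij,kl}=\Lambda^{(A,\alpha)}_{ik}T^{(B,\alpha)}_{jkl}$ or $M^{(\alpha)}_{ij,kl}=T^{(A,\alpha)}_{ikl}\Lambda^{(B,\alpha)}_{jl}$, with $\Lambda$'s local thermal operations and $T$'s thermal tensors. $\mathrm{LTOCC}_n+\mathrm M$: stochastic matrices obtained as follows. Start from $r^{(0)}_{kl}$. In round $\alpha=1,\dots,n$ one party measures. If Alice measures, $$r^{(\alpha)}_{ij,m_1\dots m_\alpha}=\sum_{k,l}\mathcal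 A^{(\alpha;m_1\dots m_{\alpha-1})}_{ik}\,\delta_{k,m_\alpha}\,\mathcal B^{(\alpha;m_1\dots m_\alpha)}_{jl}\,r^{(\alpha-1)}_{kl,m_1\dots m_{\alpha-1}},$$ where for each value of the memory indices $\mathcal A^{(\alpha;\cdot)}$, $\mathcal B^{(\alpha;\cdot)}$ are local thermal operations of Alice and Bob; if Bob measures, the same with $\delta_{l,m_\alpha}$, Alice's operation conditioned on $m_1,\dots,m_\alpha$ and Bob's on $m_1,\dots,m_{\alpha-1}$. At the end $m_1,\dots,m_n$ are summed over. *)

(* Defs.v *)
From HB Require Import structures.
From mathcomp Require Import all_boot all_order all_algebra.

Set Implicit Arguments.
Unset Strict Implicit.
Unset Printing Implicit Defensive.

Import Order.TTheory GRing.Theory Num.Theory.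

Local Open Scope ring_scope.

(* Conventions.  Stochastic matrices are column-stochastic and act on column
   vectors.  A joint state r_{kl} of Alice and Bob is a matrix r : 'M_(dA, dB),
   and the composite index (i, j) of a joint operation M_{ij,kl} is
   mxvec_index i j : 'I_(dA * dB). *)

Definition stochastic (R : realFieldType) (d : nat) (L : 'M[R]_d) : Prop :=
  (forall i k, 0 <= L i k) /\ (forall k, \sum_i L i k = 1).

Definition gibbs (R : realFieldType) (d : nat) (g : 'cV[R]_d) : Prop :=
  (forall i, 0 < g i 0) /\ \sum_i g i 0 = 1.

Definition thermal (R : realFieldType) (d : nat) (g : 'cV[R]_d) (L : 'M[R]_d)
  : Prop := stochastic L /\ L *m g = g.

Definition joint_state (R : realFieldType) (dA dB : nat) (r : 'M[R]_(dA, dB))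
  : Prop := (forall k l, 0 <= r k l) /\ \sum_k \sum_l r k l = 1.

(* T j k l is T^(B)_{jkl}. *)
Definition thermal_tensorB (R : realFieldType) (dA dB : nat) (gB : 'cV[R]_dB)
    (T : 'I_dB -> 'I_dA -> 'I_dB -> R) : Prop :=
  [/\ forall j k l, 0 <= T j k l,
      forall k l, \sum_j T j k l = 1
    & forall j k, \sum_l T j k l * gB l 0 = gB j 0].

(* T i k l is T^(A)_{ikl}. *)
Definition thermal_tensorA (R : realFieldType) (dA dB : nat) (gA : 'cV[R]_dA)
    (T : 'I_dA -> 'I_dA -> 'I_dB -> R) : Prop :=
  [/\ forall i k l, 0 <= T i k l,
      forall k l, \sum_i T i k l = 1
    & forall i l, \sum_k T i k l * gA k 0 = gA i 0].

Definition LTOCC_round (R : realFieldType) (dA dB : nat)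
    (gA : 'cV[R]_dA) (gB : 'cV[R]_dB) (M : 'M[R]_(dA * dB)) : Prop :=
  stochastic M /\
  ((exists (L : 'M[R]_dA) (T : 'I_dB -> 'I_dA -> 'I_dB -> R),
      [/\ thermal gA L, thermal_tensorB gB T
        & forall i j k l,
            M (mxvec_index i j) (mxvec_index k l) = L i k * T j k l])
   \/
   (exists (T : 'I_dA -> 'I_dA -> 'I_dB -> R) (L : 'M[R]_dB),
      [/\ thermal_tensorA gA T, thermal gB L
        & forall i j k l,
            M (mxvec_index i j) (mxvec_index k l) = T i k l * L j l])).

Definition LTOCC (R : realFieldType) (dA dB : nat)
    (gA : 'cV[R]_dA) (gB : 'cV[R]_dB) (n : nat) (M : 'M[R]_(dA * dB)) : Prop :=
  exists Ms : 'I_n -> 'M[R]_(dA * dB),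
    (forall a, LTOCC_round gA gB (Ms a)) /\ M = \prod_(a < n) Ms a.

(* [memory_protocol gA gB n mem F]: F describes n rounds with memory, where
   mem is the type of the values of (m_1, ..., m_n) and F r0 m is r^(n)_{..,m}
   when the initial state is r^(0) = r0.  An outcome m_a ranges over the levels
   of the party measuring in round a; that party is fixed for each round and
   does not depend on the memory. *)
Inductive memory_protocol (R : realFieldType) (dA dB : nat)
    (gA : 'cV[R]_dA) (gB : 'cV[R]_dB) :
    nat -> forall mem : finType,
      ('M[R]_(dA, dB) -> mem -> 'M[R]_(dA, dB)) -> Prop :=
| memory_start :
    @memory_protocol R dA dB gA gB 0 unit (fun r0 _ => r0)
| memory_Alice (n : nat) (mem : finType)
    (F : 'M[R]_(dA, dB) -> mem -> 'M[R]_(dA, dB))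
    (A : mem -> 'M[R]_dA) (B : mem * 'I_dA -> 'M[R]_dB) :
    memory_protocol gA gB n F ->
    (forall m, thermal gA (A m)) -> (forall m, thermal gB (B m)) ->
    @memory_protocol R dA dB gA gB n.+1 (mem * 'I_dA)%type
      (fun r0 m => \matrix_(i, j) \sum_k \sum_l
         A m.1 i k * (k == m.2)%:R * B m j l * F r0 m.1 k l)
| memory_Bob (n : nat) (mem : finType)
    (F : 'M[R]_(dA, dB) -> mem -> 'M[R]_(dA, dB))
    (A : mem * 'I_dB -> 'M[R]_dA) (B : mem -> 'M[R]_dB) :
    memory_protocol gA gB n F ->
    (forall m, thermal gA (A m)) -> (forall m, thermal gB (B m)) ->
    @memory_protocol R dA dB gA gB n.+1 (mem * 'I_dB)%type
      (fun r0 m => \matrix_(i, j) \sum_k \sum_l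
         A m i k * (l == m.2)%:R * B m.1 j l * F r0 m.1 k l).

Definition LTOCC_M (R : realFieldType) (dA dB : nat)
    (gA : 'cV[R]_dA) (gB : 'cV[R]_dB) (n : nat) (M : 'M[R]_(dA * dB)) : Prop :=
  stochastic M /\
  exists (mem : finType) (F : 'M[R]_(dA, dB) -> mem -> 'M[R]_(dA, dB)),
    memory_protocol gA gB n F /\
    forall r0 : 'M[R]_(dA, dB), joint_state r0 -> forall i j,
      \sum_(m : mem) F r0 m i j =
      \sum_k \sum_l M (mxvec_index i j) (mxvec_index k l) * r0 k l.

(* Main.v *)
Require Import Defs.
From HB Require Import structures.
From mathcomp Require Import all_boot all_order all_algebra.

Set Implicit Arguments.
Unset Strict Implicit.
Unset Printing Implicit Defensive.

Import Order.TTheory GRing.Theory Num.Theory.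

Local Open Scope ring_scope.

(** A protocol is padded with idle rounds.  Without memory an idle round is the
    identity matrix.  With memory, Alice measures and nobody acts: the state is
    classical, so summing over her outcome restores it. *)

Lemma sum_delta_mull (R : pzSemiRingType) (I : finType) (i : I) (f : I -> R) :
  \sum_k (i == k)%:R * f k = f i.
Proof.
rewrite (bigD1 i) //= eqxx mul1r big1 ?addr0 // => k /negPf nki.
by rewrite eq_sym nki mul0r.
Qed.

Lemma stochastic1 (R : realFieldType) (d : nat) : stochastic (1%:M : 'M[R]_d).
Proof.
split=> [i k|k]; first by rewrite mxE ler0n.
rewrite -[RHS](sum_delta_mull k (fun=> 1)); apply: eq_bigr => i _.
by rewrite mxE mulr1 eq_sym.
Qed.

Lemma thermal1 (R : realFieldType) (d : nat) (g : 'cV[R]_d) : thermal g 1%:M.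
Proof. by split; [exact: stochastic1 | rewrite mul1mx]. Qed.

Lemma LTOCC_round1 (R : realFieldType) (dA dB : nat)
    (gA : 'cV[R]_dA) (gB : 'cV[R]_dB) : LTOCC_round gA gB 1%:M.
Proof.
split; first exact: stochastic1.
(* Bob's identity becomes a tensor that ignores Alice's input [k]. *)
left; exists 1%:M, (fun j _ l => (j == l)%:R); split; first exact: thermal1.
- split=> [j k l|k l|j k]; first exact: ler0n.
  + rewrite -[RHS](sum_delta_mull l (fun=> 1)); apply: eq_bigr => j _.
    by rewrite mulr1 eq_sym.
  + exact: sum_delta_mull.
(* [mxvec_index] is a cast of [enum_rank], hence injective, so the joint identity has entries
   $\delta_{ik}\delta_{jl}$. *)
- move=> i j k l; rewrite !mxE (inj_eq (@cast_ord_inj _ _ _)).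
  by rewrite (inj_eq enum_rank_inj) xpair_eqE -mulnb natrM.
Qed.

Lemma LTOCC_succ (R : realFieldType) (dA dB : nat)
    (gA : 'cV[R]_dA) (gB : 'cV[R]_dB) (n : nat) (M : 'M[R]_(dA * dB)) :
  LTOCC gA gB n M -> LTOCC gA gB n.+1 M.
Proof.
(* The default [1%:M] sits at [ord0]: it is the leftmost factor, so the idle round acts last on
   column vectors. *)
case=> Ms [hMs ->]; exists (fun a => oapp Ms 1%:M (unlift ord0 a)); split.
  by move=> a; case: unlift => [b|] /=; [exact: hMs | exact: LTOCC_round1].
rewrite big_ord_recl unlift_none /= mul1r.
by apply: eq_bigr => a _; rewrite liftK.
Qed.

Lemma LTOCC_M_succ (R : realFieldType) (dA dB : nat)
    (gA : 'cV[R]_dA) (gB : 'cV[R]_dB) (n : nat) (M : 'M[R]_(dA * dB)) :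
  LTOCC_M gA gB n M -> LTOCC_M gA gB n.+1 M.
Proof.
case=> stM [mem [F [hF MF]]]; split=> //.
exists (mem * 'I_dA)%type; eexists; split.
  exact: (memory_Alice hF (fun=> thermal1 gA) (fun=> thermal1 gB)).
move=> r0 hr0 i j; rewrite -MF //.
(* With both operations equal to the identity, the sums over [k] and [l] collapse to [k = i],
   [l = j]; what remains of the measurement is that the outcome [p.2] equals the output level
   [i]. *)
transitivity (\sum_(p : mem * 'I_dA) (i == p.2)%:R * F r0 p.1 i j).
  apply: eq_bigr => -[m a] _; rewrite mxE /=.
  rewrite -[RHS](sum_delta_mull i (fun k => (k == a)%:R * F r0 m k j)).
  apply: eq_bigr => k _; rewrite -[F r0 m k j](sum_delta_mull j (F r0 m k)).
  by rewrite !mulr_sumr; apply: eq_bigr => l _; rewrite !mxE !mulrA.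
(* For fixed old memory [m], exactly one new outcome, [a = i], contributes. *)
rewrite -(pair_bigA _ (fun m a => (i == a)%:R * F r0 m i j)).
by apply: eq_bigr => m _; apply: sum_delta_mull.
Qed.

Theorem mainTheorem10 (R : realFieldType) (dA dB : nat)
    (gA : 'cV[R]_dA) (gB : 'cV[R]_dB) (hA : gibbs gA) (hB : gibbs gB)
    (n' n : nat) (hn' : (1 <= n')%N) (hn : (n' <= n)%N) :
  (forall M : 'M[R]_(dA * dB), LTOCC gA gB n' M -> LTOCC gA gB n M) /\
  (forall M : 'M[R]_(dA * dB), LTOCC_M gA gB n' M -> LTOCC_M gA gB n M).
Proof.
(* Induction on the number of idle rounds; as it is the left summand, [k.+1 + n'] converts to
   [(k + n').+1]. *)
rewrite -(subnK hn); elim: (n - n')%N => [|k [IH IHM]]; first by split.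
by split=> M hM; [apply: LTOCC_succ; apply: IH | apply: LTOCC_M_succ; apply: IHM].
Qed.
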